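(* Let $w=(w_{ijk})\in(\mathbb{C}^* )^{2\times2\times2}$. If there exists a square cup $U=\{U_1,U_2,U_3\}$ such that each of the $2$-minors $U_1,U_2,U_3$ vanishes on $w$, then the hyperdeterminant of $w$ vanishes.
   Context: A slice of a $2\times2\times2$ tensor $(w_{ijk})$ of variables is one of the six $2\times2$ matrices obtained by fixing one of the indices $i,j,k$; its $2$-minor is its determinant. A square cup is a set $U=\{U_1,U_2,U_3\}$ of three distinct $2$-minors of slices (all contained in one $2\times2\times2$ tensor) such that $U_1$ and $U_2$ have disjoint sets of variables. The ($2\times2\times2$, Cayley) hyperdeterminant of $w$ is, writing $(w_1,\dots,w_8)=(w_{111},w_{112},w_{121},w_{122},w_{211},w_{212},w_{221},w_{222})$, $$w_4^2w_5^2+w_3^2w_6^2+w_2^2w_7^2+w_1^2w_8^2-2w_3w_4w_5w_6-2w_2w_4w_5w_7-2w_2w_3w_6w_7-2w_1w_4w_5w_8-2w_1w_3w_6w_8-2w_1w_2w_7w_8+4w_1w_4w_6w_7+4w_2w_3w_5w_8.$$ *)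

(* Defs.v *)
From mathcomp Require Import all_boot all_order all_algebra.
From mathcomp Require Import finmap.
From mathcomp Require Import reals complex mpoly.

Set Implicit Arguments.
Unset Strict Implicit.
Unset Printing Implicit Defensive.

Import GRing.Theory.
Local Open Scope ring_scope.

(* Indices run over {0, 1} instead of {1, 2}: w i j k is w_{i+1,j+1,k+1}. *)
Definition tensor222 (A : Type) : Type := 'I_2 -> 'I_2 -> 'I_2 -> A.

Definition slice (A : Type) (t : tensor222 A) (d : 'I_3) (b : 'I_2) : 'M[A]_2 :=
  match val d with
  | 0%N => \matrix_(j, k) t b j k
  | 1%N => \matrix_(i, k) t i b k
  | _ => \matrix_(i, j) t i j b
  end.

(* The library's polynomials have variables indexed by an ordinal type, so the
   index triples (i, j, k) are numbered by enum_rank. *)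
Definition index222 : finType := ('I_2 * 'I_2 * 'I_2)%type.

Definition poly222 (K : comNzRingType) := {mpoly K[#|{: index222}|]}.

Definition generic222 (K : comNzRingType) : tensor222 (poly222 K) :=
  fun i j k => 'X_(enum_rank ((i, j, k) : index222)).

Definition point222 (K : comNzRingType) (w : tensor222 K) :
    'I_#|{: index222}| -> K :=
  fun v => let: (i, j, k) := enum_val v : index222 in w i j k.

Definition slice_minor (K : comNzRingType) (p : poly222 K) : Prop :=
  exists d b, p = \det (slice (generic222 K) d b).

Definition mvars (n : nat) (K : comNzRingType) (p : {mpoly K[n]}) : {set 'I_n} :=
  [set v | has (fun m : 'X_{1..n} => m v != 0%N) (msupp p)].

Definition square_cup (K : comNzRingType) (U : {fset poly222 K}) : Prop :=
  exists U1 U2 U3 : poly222 K,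
    [/\ U = [fset U1; U2; U3]%fset,
        [/\ slice_minor U1, slice_minor U2 & slice_minor U3],
        [/\ U1 <> U2, U1 <> U3 & U2 <> U3]
      & [disjoint mvars U1 & mvars U2]].

Definition hyperdet222 (K : comNzRingType) (w : tensor222 K) : K :=
  let w1 := w 0 0 0 in let w2 := w 0 0 1 in
  let w3 := w 0 1 0 in let w4 := w 0 1 1 in
  let w5 := w 1 0 0 in let w6 := w 1 0 1 in
  let w7 := w 1 1 0 in let w8 := w 1 1 1 in
  w4 ^+ 2 * w5 ^+ 2 + w3 ^+ 2 * w6 ^+ 2 + w2 ^+ 2 * w7 ^+ 2 + w1 ^+ 2 * w8 ^+ 2
  - 2%:R * w3 * w4 * w5 * w6 - 2%:R * w2 * w4 * w5 * w7
  - 2%:R * w2 * w3 * w6 * w7 - 2%:R * w1 * w4 * w5 * w8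
  - 2%:R * w1 * w3 * w6 * w8 - 2%:R * w1 * w2 * w7 * w8
  + 4%:R * w1 * w4 * w6 * w7 + 4%:R * w2 * w3 * w5 * w8.

(* Main.v *)
Require Import Defs.
From mathcomp Require Import all_boot all_order all_algebra.
From mathcomp Require Import finmap.
From mathcomp Require Import reals complex mpoly.
From mathcomp Require Import ring.
Local Open Scope ring_scope.
Import GRing.Theory.

(** Write A and B for the two parallel slices of w in a fixed direction. The
    hyperdeterminant is the discriminant of the binary quadratic form
    det (x A + y B), that is m ^ 2 - 4 det A det B, where m is the coefficient
    of x y, the polarization of the determinant; this holds in each of the
    three directions ([hyperdet222_disc]).

    Two slices in different directions share an edge of the cube, hence a
    variable, and every entry of a generic slice occurs in its minor. So the
    disjoint minors U1 and U2 of a square cup come from the two parallel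
    slices of one direction ([disjoint_slice_minors]), and U3, being different
    from both, comes from a slice in another direction. Therefore det A = 0
    and det B = 0, and it remains to see that m = 0.

    The third slice joins a row of A to the same row of B, or a column of A to
    the same column of B ([slice_det_lines]); up to transposition, its minor
    says that A and B have a proportional row. As no entry vanishes, the
    singular matrices A and B then have all their rows on one common line, so
    x A + y B is singular for all x and y, and m = 0 ([mixed_det_eq0]). *)

Lemma ord2_eq01 (i : 'I_2) : i = 0 \/ i = 1.
Proof. by case: i => [[|[|//]] ?]; [left | right]; apply: val_inj. Qed.

Lemma ord2_neq (b c i : 'I_2) : b != c -> i = b \/ i = c.
Proof.
by case: (ord2_eq01 b) => ->; case: (ord2_eq01 c) => -> //= _;
  case: (ord2_eq01 i); tauto.
Qed.

Lemma det_mx22 (K : comNzRingType) (A : 'M[K]_2) :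
  \det A = A 0 0 * A 1 1 - A 0 1 * A 1 0.
Proof.
rewrite (expand_det_row _ 0) big_ord_recl big_ord1 /cofactor !det_mx11 !mxE /=.
rewrite expr0 expr1 mul1r mulN1r mulrN.
by congr (_ * A _ _ - A _ _ * A _ _); apply: val_inj.
Qed.

(** The coefficient of x y in det (x A + y B). *)
Definition mixed_det (K : comNzRingType) (A B : 'M[K]_2) : K :=
  A 0 0 * B 1 1 + A 1 1 * B 0 0 - A 0 1 * B 1 0 - A 1 0 * B 0 1.

Lemma mixed_det_tr (K : comNzRingType) (A B : 'M[K]_2) :
  mixed_det K A^T B^T = mixed_det K A B.
Proof. by rewrite /mixed_det !mxE; ring. Qed.

Lemma hyperdet222_disc (K : comNzRingType) (w : tensor222 K) (d : 'I_3) :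
  hyperdet222 w = mixed_det K (slice w d 0) (slice w d 1) ^+ 2
                  - 4%:R * \det (slice w d 0) * \det (slice w d 1).
Proof.
rewrite !det_mx22 /mixed_det /hyperdet222.
by case: d => [[|[|[|//]]] ?]; rewrite /slice /= !mxE; ring.
Qed.

(** All rows of A and B lie on the line of their i-th rows, so the whole pencil
    that they span is singular. The proof is a certificate of this: after
    multiplication by the nonzero A i 0 * B i 0, the polarized determinant is
    an explicit combination of the three vanishing quantities. *)
Lemma mixed_det_eq0 (K : idomainType) (A B : 'M[K]_2) (i : 'I_2) :
  (forall j k, A j k != 0) -> (forall j k, B j k != 0) ->
  \det A = 0 -> \det B = 0 -> A i 0 * B i 1 = A i 1 * B i 0 ->
  mixed_det K A B = 0.
Proof.
move=> nzA nzB detA detB /eqP; rewrite -subr_eq0 => /eqP rowi.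
apply: (mulfI (nzA i 0)); apply: (mulfI (nzB i 0)); rewrite !mulr0.
have -> : B i 0 * (A i 0 * mixed_det K A B) =
    A i 0 ^+ 2 * \det B + B i 0 ^+ 2 * \det A
    + (A i 0 * B i 1 - A i 1 * B i 0)
      * (A 0 0 * B 1 0 - A 1 0 * B 0 0).
  (* Exchanging the rows in both A and B changes the signs of the polarized
     determinant, of det A and det B and of the factor free of i, so one
     formula serves for both values of i. *)
  by rewrite !det_mx22 /mixed_det; case: (ord2_eq01 i) => ->; ring.
by rewrite detA detB rowi !mulr0 mul0r !addr0.
Qed.

(** In the pair of slices of direction d, the slice b of another direction
    consists of the two rows, or of the two columns, of index b. Which of the
    two occurs depends on the order of d and d' in the list of the three
    directions. *)
Lemma slice_det_lines (K : comNzRingType) (w : tensor222 K) (d d' : 'I_3)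
    (b : 'I_2) :
  d != d' -> \det (slice w d' b) = 0 ->
  let A := slice w d 0 in let B := slice w d 1 in
  A b 0 * B b 1 = A b 1 * B b 0 \/ A 0 b * B 1 b = A 1 b * B 0 b.
Proof.
rewrite det_mx22 => neq_dd' /eqP; rewrite subr_eq0 => /eqP; move: neq_dd'.
case: d => [[|[|[|//]]] ?]; case: d' => [[|[|[|//]]] ?] // _;
  rewrite /slice /= !mxE => ->.
- by left.
- by right.
- by left.
- by right; rewrite mulrC.
- by left; rewrite mulrC.
- by right; rewrite mulrC.
Qed.

Lemma hyperdet222_eq0 (K : idomainType) (w : tensor222 K) (d d' : 'I_3)
    (b : 'I_2) :
  (forall i j k, w i j k != 0) -> d != d' ->
  (forall c, \det (slice w d c) = 0) -> \det (slice w d' b) = 0 ->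
  hyperdet222 w = 0.
Proof.
move=> nzw neq_dd' det0 det0'.
rewrite (hyperdet222_disc _ _ d) !det0 mulr0 subr0.
suff -> : mixed_det K (slice w d 0) (slice w d 1) = 0 by rewrite expr0n.
have nz c i j : slice w d c i j != 0.
  by rewrite /slice; case: (val d) => [|[|?]]; rewrite mxE.
case: (slice_det_lines _ _ _ _ _ neq_dd' det0') => [row|col].
  exact: (mixed_det_eq0 _ _ _ b (nz 0) (nz 1) (det0 0) (det0 1) row).
rewrite -mixed_det_tr; apply: (mixed_det_eq0 _ _ _ b);
  by [move=> j k; rewrite mxE | rewrite det_tr | rewrite !mxE].
Qed.

Lemma map_slice (A B : Type) (f : A -> B) (t : tensor222 A) d b :
  slice (fun i j k => f (t i j k)) d b = map_mx f (slice t d b).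
Proof.
by rewrite /slice; case: (val d) => [|[|?]]; apply/matrixP=> i j; rewrite !mxE.
Qed.

Lemma slice_minor_eval (K : comNzRingType) (w : tensor222 K) d b :
  (\det (slice (generic222 K) d b)).@[point222 w] = \det (slice w d b).
Proof.
rewrite -det_map_mx -map_slice; congr (\det _).
rewrite /slice; case: (val d) => [|[|?]]; apply/matrixP=> i j;
  by rewrite !mxE /= /generic222 mevalXU /point222 enum_rankK.
Qed.

(** The slices of this tensor record the positions in the cube of the entries of
    any other slice; this reduces incidence questions to equality of index
    triples. *)
Definition index_tensor : tensor222 index222 := fun i j k => (i, j, k).

(** The two monomials of a generic 2 x 2 determinant are distinct, hence do not
    cancel, and every entry of the matrix divides one of them. *)
Lemma mvars_det_generic (n : nat) (K : comNzRingType) (f : 'I_2 -> 'I_2 -> 'I_n)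
    (i j : 'I_2) :
  (forall i j i' j', f i j = f i' j' -> i = i' /\ j = j') ->
  f i j \in mvars (\det (\matrix_(i, j) 'X_(f i j) : 'M[{mpoly K[n]}]_2)).
Proof.
move=> f_inj.
have fE i1 j1 i2 j2 : (f i1 j1 == f i2 j2) = (i1 == i2) && (j1 == j2).
  by apply/eqP/andP=> [/f_inj[-> ->]//|[/eqP-> /eqP->]].
rewrite inE; apply/hasP.
rewrite det_mx22 !mxE -!mpolyXD.
(* The entry (i, j) lies in the diagonal or in the antidiagonal monomial; in
   both cases the exponent of f 0 0 tells the two monomials apart. *)
have [->|neq_ij] := eqVneq i j.
  exists (U_((f 0 0)%R) + U_((f 1 1)%R))%MM; last first.
    by rewrite mnmDE !mnm1E !fE; case: (ord2_eq01 j) => ->.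
  rewrite mcoeff_msupp mcoeffB !mcoeffX eqxx.
  case: (_ =P _ :> 'X_{1..n}) => [/mnmP/(_ (f 0 0))|_];
    last by rewrite subr0 oner_neq0.
  by rewrite !mnmDE !mnm1E !fE.
exists (U_((f 0 1)%R) + U_((f 1 0)%R))%MM; last first.
  rewrite mnmDE !mnm1E !fE; move: neq_ij.
  by case: (ord2_eq01 i) => ->; case: (ord2_eq01 j) => ->.
rewrite mcoeff_msupp mcoeffB !mcoeffX eqxx.
case: (_ =P _ :> 'X_{1..n}) => [/mnmP/(_ (f 0 0))|_];
  last by rewrite sub0r oppr_eq0 oner_neq0.
by rewrite !mnmDE !mnm1E !fE.
Qed.

(** Faces of the cube that are not parallel share an edge; the witness is the end
    of this edge whose coordinate in the third direction is 0. *)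
Lemma slices_meet (d d' : 'I_3) (b b' : 'I_2) : d != d' ->
  exists i j i' j', slice index_tensor d b i j = slice index_tensor d' b' i' j'.
Proof.
case: d => [[|[|[|//]]] ?]; case: d' => [[|[|[|//]]] ?] // _;
  rewrite /slice /=.
- by exists b', 0, b, 0; rewrite !mxE.
- by exists 0, b', b, 0; rewrite !mxE.
- by exists b', 0, b, 0; rewrite !mxE.
- by exists 0, b', 0, b; rewrite !mxE.
- by exists b', 0, 0, b; rewrite !mxE.
- by exists 0, b', 0, b; rewrite !mxE.
Qed.

Lemma slice_inj d b (i j i' j' : 'I_2) :
  slice index_tensor d b i j = slice index_tensor d b i' j' ->
  i = i' /\ j = j'.
Proof. by rewrite /slice; case: (val d) => [|[|?]]; rewrite !mxE => -[]. Qed.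

Lemma mvars_slice_minor (K : comNzRingType) d b (i j : 'I_2) :
  enum_rank (slice index_tensor d b i j)
    \in mvars (\det (slice (generic222 K) d b)).
Proof.
have -> : slice (generic222 K) d b =
    \matrix_(i, j) 'X_(enum_rank (slice index_tensor d b i j)).
  rewrite (map_slice _ _ (fun x : index222 => 'X_(enum_rank x)) index_tensor).
  by apply/matrixP=> i' j'; rewrite !mxE.
apply: (mvars_det_generic _ _
  (fun i j => enum_rank (slice index_tensor d b i j))).
by move=> i1 j1 i2 j2 /enum_rank_inj; apply: slice_inj.
Qed.

Lemma disjoint_slice_minors (K : comNzRingType) (d d' : 'I_3) (b b' : 'I_2) :
  [disjoint mvars (\det (slice (generic222 K) d b))
          & mvars (\det (slice (generic222 K) d' b'))] -> d = d'.
Proof.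
move=> dis; apply/eqP/negPn/negP=> /(slices_meet _ _ b b')[i [j [i' [j' e]]]].
have := disjointFr dis (mvars_slice_minor K d b i j).
by rewrite e mvars_slice_minor.
Qed.

Lemma mem_fset3 (T : choiceType) (x y z : T) (A := [fset x; y; z]%fset) :
  [/\ x \in A, y \in A & z \in A].
Proof. by rewrite /A !inE !eqxx !orbT. Qed.

(** The argument is valid over any integral domain: the only division is the
    cancellation of nonzero entries of w. *)
Lemma square_cup_hyperdet222_eq0 (K : idomainType) (w : tensor222 K)
    (U : {fset poly222 K}) :
  (forall i j k, w i j k != 0) -> square_cup U ->
  (forall p : poly222 K, p \in U -> p.@[point222 w] = 0) ->
  hyperdet222 w = 0.
Proof.
move=> nzw [U1 [U2 [U3 [defU [m1 m2 m3] neqs disj]]]] U0.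
have [U1in U2in U3in] := mem_fset3 _ U1 U2 U3; rewrite -defU in U1in U2in U3in.
have v1 := U0 _ U1in; have v2 := U0 _ U2in; have v3 := U0 _ U3in.
case: m1 m2 m3 neqs disj v1 v2 v3 {defU}.
move=> d1 [b1 ->] [d2 [b2 ->]] [d3 [b3 ->]] [neq12 neq13 neq23].
move=> /disjoint_slice_minors e12; rewrite -{d2}e12 in neq12 neq23 *.
rewrite !slice_minor_eval => det1 det2 det3.
have neq_b : b1 != b2 by apply: contra_notN neq12 => /eqP->.
apply: (hyperdet222_eq0 _ w d1 d3 b3) => [//||c|//].
- apply/eqP=> e13; rewrite -e13 in neq13 neq23.
  by case: (ord2_neq _ _ b3 neq_b) => e; rewrite e in neq13 neq23.
by case: (ord2_neq _ _ c neq_b) => ->.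
Qed.

Theorem proposition2p31 (R : realType) (w : tensor222 R[i])
  (hw : forall i j k : 'I_2, w i j k <> 0)
  (hU : exists U : {fset poly222 R[i]},
      square_cup U /\
      (forall p : poly222 R[i], p \in U -> p.@[point222 w] = 0)) :
  hyperdet222 w = 0.
Proof.
case: hU => U [cupU U0]; apply: (square_cup_hyperdet222_eq0 _ w U _ cupU U0).
by move=> i j k; apply/eqP.
Qed.
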